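(* Let $X$ be a compact metrizable space with $|X|\ge 2$. Let $\mathcal{PM}$ be the set of all continuous pseudometrics defined on nonempty compact subsets of $X$, and let $\tilde{\mathcal M}\subset\mathcal{PM}$ be the set of all continuous metrics defined on compact subsets of $X$ having at least two points. Then there exists a regular extension operator $\tilde u\colon\mathcal{PM}\to\mathcal{PM}(X)$ such that $\tilde u(\tilde{\mathcal M})\subset\mathcal M(X)$.
   Context: $\exp X$ denotes the set of all nonempty compact subsets of $X$. For $A\in\exp X$, $\mathcal{M}(A)$ (respectively $\mathcal{PM}(A)$) is the set of continuous metrics (respectively continuous pseudometrics) on $A$; $\mathcal{PM}=\bigcup\{\mathcal{PM}(A)\mid A\in\exp X\}$ and $\tilde{\mathcal M}=\bigcup\{\mathcal M(A)\mid A\in\exp X,\ |A|\ge2\}$. If $\varrho\in\mathcal{PM}(A)$ we write $\operatorname{dom}\varrho=A$. The norm of $\varrho\in\mathcal{PM}$ is $\|\varrho\|=\sup\{\varrho(x,y)\mid x,y\in\operatorname{dom}\varrho\}$. A map $u\colon\mathcal{PM}\to\mathcal{PM}(X)$ is regular if $\|u(\varrho)\|=\|\varrho\|$ for every $\varrho\in\mathcal{PM}$, and is an extension operator if $u(\varrho)|(\operatorname{dom}\varrho\times\operatorname{dom}\varrho)=\varrho$ for every $\varrho\in\mathcal{PM}$. *)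

(* Defs.v *)
From mathcomp Require Import all_boot all_order all_algebra.
From mathcomp Require Import all_classical all_reals all_analysis.

Set Implicit Arguments.
Unset Strict Implicit.
Unset Printing Implicit Defensive.

Import Order.TTheory GRing.Theory Num.Theory.
Import numFieldNormedType.Exports.

Local Open Scope classical_set_scope.
Local Open Scope ring_scope.

Definition is_pseudometric (R : realType) (T : Type) (d : T -> T -> R) : Prop :=
  [/\ forall x y, 0 <= d x y,
      forall x, d x x = 0,
      forall x y, d x y = d y x
    & forall x y z, d x z <= d x y + d y z].

Definition is_metric (R : realType) (T : Type) (d : T -> T -> R) : Prop :=
  is_pseudometric d /\ forall x y, d x y = 0 -> x = y.

Definition metrizable (R : realType) (X : topologicalType) : Prop :=
  exists2 d : X -> X -> R, is_metric d &
    forall (x : X) (U : set X),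
      nbhs x U <-> exists2 e : R, 0 < e & [set y | d x y < e] `<=` U.

(* Continuity is joint continuity on the product space [T * T]. *)
Record cont_pseudometric (R : realType) (T : topologicalType) := ContPseudometric {
  cpm_fun :> T -> T -> R ;
  cpm_is_pseudometric : is_pseudometric cpm_fun ;
  cpm_continuous : continuous (fun p : T * T => cpm_fun p.1 p.2)
}.

(* The set PM. The carrier of [pm_dist] is the subtype [set_type pm_dom], which
   has the topology induced from [X]; so elements of PM are genuinely partial,
   with no values outside their domain. *)
Record partial_pseudometric (R : realType) (X : topologicalType) :=
  PartialPseudometric {
    pm_dom : set X ;
    pm_dom_compact : compact pm_dom ;
    pm_dom_nonempty : pm_dom !=set0 ;
    pm_dist : cont_pseudometric R (set_type pm_dom)
  }.

(* The real supremum is the intended one whenever [T] is compact and nonempty,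
   [d] then being bounded. *)
Definition cpm_norm (R : realType) (T : topologicalType)
    (d : cont_pseudometric R T) : R :=
  sup [set d p.1 p.2 | p in [set: T * T]].

Definition Mtilde (R : realType) (X : topologicalType) :
    set (partial_pseudometric R X) :=
  [set rho | is_metric (pm_dist rho) /\
             exists x y, [/\ pm_dom rho x, pm_dom rho y & x <> y]].

Definition regular (R : realType) (X : topologicalType)
    (u : partial_pseudometric R X -> cont_pseudometric R X) : Prop :=
  forall rho, cpm_norm (u rho) = cpm_norm (pm_dist rho).

Definition extension_operator (R : realType) (X : topologicalType)
    (u : partial_pseudometric R X -> cont_pseudometric R X) : Prop :=
  forall rho (x y : set_type (pm_dom rho)),
    u rho (set_val x) (set_val y) = pm_dist rho x y.

(* Main.v *)
(** Fix a compatible metric [d] on [X] and a pseudometric [rho] on [A] of norm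
    [N]. By compactness, for each [e > 0] there is [k] with [rho <= k d + e], so
    the infimum of [N] and of all [k d + c] ([k >= 1], [c >= 0]) dominating [rho]
    is a continuous pseudometric [delta] on [X] with [rho <= delta <= N] (a
    metric if [N > 0]). The infimum of [delta x y] and of all
    [delta x a + rho a b + delta b y] with [a], [b] in [A] then extends [rho]
    without increasing its norm. No continuity of the operator is required, so
    the extensions can be chosen independently of each other. *)

Require Import Defs.
From mathcomp Require Import all_boot all_order all_algebra.
From mathcomp Require Import all_classical all_reals all_analysis.
From mathcomp Require Import ring lra.

Import Order.TTheory GRing.Theory Num.Theory.
Import numFieldNormedType.Exports.

Local Open Scope classical_set_scope.
Local Open Scope ring_scope.

(** * Compactness, continuity, and infima of candidate distances *)

Lemma compact_set_type {X : topologicalType} {A : set X} :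
  compact A -> compact [set: set_type A].
Proof.
move=> cA F PF _.
have FA : (set_val @ F) A.
  by apply: (@filterS _ F _ setT) filterT => x _; exact: set_valP.
have [p [Ap clp]] := cA _ _ FA.
exists (exist _ p (mem_set Ap)); split => // C B FC [_ [[V oV <-] Vp] VB].
have [|_ [[c Cc <-] Vc]] := clp (set_val @` C) V _ (open_nbhs_nbhs (conj oV Vp)).
  by apply: (@filterS _ F _ C) FC => c Cc; exists c.
by exists c; split => //; exact: VB.
Qed.

(** At each point some [n] gives the inequality strictly: [0] where [g] vanishes, an Archimedean
    choice elsewhere. It persists nearby by continuity and for larger [n] because [g] is
    nonnegative, so compactness makes [n] uniform. *)
Lemma compact_dominated {R : realType} {T : topologicalType} (f g : T -> R)
    (e : R) :
  compact [set: T] -> continuous f -> continuous g ->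
  (forall x, 0 <= g x) -> (forall x, g x = 0 -> f x <= 0) -> 0 < e ->
  exists n : nat, forall x, f x <= n%:R * g x + e.
Proof.
move=> /compact_near_coveringP cT cf cg g0 fg e0.
have [|n _ nP] := cT nat \oo (fun n x => f x <= n%:R * g x + e) _.
  move=> x _.
  have [n fxn] : exists n : nat, f x - n%:R * g x < e.
    have [gx0|gx0] := eqVneq (g x) 0.
      by exists 0%N; rewrite mul0r subr0; apply: le_lt_trans e0; exact: fg.
    have gx_gt0 : 0 < g x by rewrite lt_neqAle eq_sym gx0 g0.
    exists (Num.truncn (f x / g x)).+1.
    have := truncnS_gt (f x / g x); rewrite ltr_pdivrMr// => h.
    by lra.
  have cfg : (fun y => f y - n%:R * g y) @ x --> f x - n%:R * g x.
    by apply: cvgB; [exact: cf|apply: cvgM; [exact: cvg_cst|exact: cg]].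
  near=> y m.
  have h1 : f y - n%:R * g y < e by near: y; exact: cvgr_lt cfg _ fxn.
  have h2 : n%:R * g y <= m%:R * g y.
    by rewrite ler_wpM2r// ler_nat; near: m; exact: nbhs_infty_ge.
  by lra.
by exists n => x; exact: nP (leqnn n) x I.
Unshelve. all: end_near. Qed.

(** The triangle inequality bounds the change of [d] from [(x, y)] to [(x', y')] by
    [d x x' + d y y']. *)
Lemma pseudometric_continuous {R : realType} {T : topologicalType}
    (d : T -> T -> R) :
  is_pseudometric d ->
  (forall x e, 0 < e -> \forall y \near x, d x y < e) ->
  continuous (fun p : T * T => d p.1 p.2).
Proof.
move=> [_ _ dC dT] dnear [x y]; apply/cvgrPdist_lt => e e0.
have e20 : 0 < e / 2 by rewrite divr_gt0.
exists ([set z | d x z < e / 2], [set z | d y z < e / 2]).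
  by split; exact: dnear.
move=> [x' y'] [/= hx hy]; rewrite ltr_norml.
have := dT x x' y; have := dT x' y' y; have := dT x' x y'; have := dT x y y'.
by rewrite (dC x' x) (dC y' y) => *; apply/andP; split; lra.
Qed.

Lemma cpm_continuous_comp {R : realType} {S T : topologicalType}
    (d : cont_pseudometric R T) (f g : S -> T) :
  continuous f -> continuous g -> continuous (fun x => d (f x) (g x)).
Proof.
move=> cf cg x.
apply: (@continuous_comp _ _ _ (fun x => (f x, g x)) (fun p => d p.1 p.2)).
  by apply: cvg_pair; [exact: cf|exact: cg].
exact: cpm_continuous.
Qed.

Lemma cpm_near {R : realType} {T : topologicalType}
    (d : cont_pseudometric R T) (x : T) (e : R) :
  0 < e -> \forall y \near x, d x y < e.
Proof.
move=> e0.
have [_ d0 _ _] := cpm_is_pseudometric d.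
have : (fun y => d x y) @ x --> d x x.
  by apply: (cpm_continuous_comp d (fun=> x) id) => y;
    [exact: cvg_cst|exact: cvg_id].
by rewrite d0 => /cvgr_lt; apply.
Qed.

(** The pseudometric axioms, stated for candidate values, pass to infima. On the diagonal only
    arbitrarily small candidates are asked for, since an affine bound [k d + c] with [c > 0] does
    not vanish there. *)
Lemma is_pseudometric_inf {R : realType} {T : Type} (S : T -> T -> set R) :
  (forall x y, S x y !=set0) ->
  (forall x y, lbound (S x y) 0) ->
  (forall x e, 0 < e -> exists2 s, S x x s & s <= e) ->
  (forall x y, S x y `<=` S y x) ->
  (forall x y z s t, S x y s -> S y z t -> exists2 u, S x z u & u <= s + t) ->
  is_pseudometric (fun x y => inf (S x y)).
Proof.
move=> S0 Sge0 Sxx SC ST.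
have Slb x y : has_lbound (S x y) by exists 0.
split=> [x y|x|x y|x y z].
- exact: lb_le_inf.
- apply/eqP; rewrite eq_le lb_le_inf ?andbT//.
  apply/ler_addgt0Pl => e e0; rewrite addr0.
  by have [s Ss] := Sxx x _ e0; exact/le_trans/ge_inf.
- by congr inf; apply/seteqP; split; exact: SC.
- rewrite -lerBlDr; apply: lb_le_inf => // s Ss.
  rewrite lerBlDr -lerBlDl; apply: lb_le_inf => // t St.
  rewrite lerBlDl; have [u Su] := ST _ _ _ _ _ Ss St.
  exact/le_trans/ge_inf.
Qed.

(** Domination by the constant function 1 gives the boundedness that makes [sup] a genuine
    supremum. *)
Lemma cpm_le_norm {R : realType} {T : topologicalType}
    (d : cont_pseudometric R T) (x y : T) :
  compact [set: T] -> d x y <= cpm_norm d.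
Proof.
move=> cT; apply: ub_le_sup; last by exists (x, y).
have cTT : compact [set: T * T] by rewrite -setXTT; exact: compact_setX.
have [||n nP] := @compact_dominated R (T * T)%type
  (fun p => d p.1 p.2) (fun=> 1) 1 cTT (@cpm_continuous _ _ d) _
  (fun=> ler01) _ ltr01.
- by move=> p; exact: cvg_cst.
- by move=> p /eqP; rewrite oner_eq0.
- by exists (n%:R * 1 + 1) => _ [p _ <-]; exact: nP.
Qed.

(** * A global pseudometric dominating a partial one *)

Section majorant.
Context {R : realType} {X : topologicalType} {A : set X}.
Variables (d : cont_pseudometric R X) (rho : cont_pseudometric R (set_type A)).
Variable N : R.
Hypotheses (d_metric : is_metric d) (cA : compact A).
Hypotheses (N_ge0 : 0 <= N) (rho_le : forall a b, rho a b <= N).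

Let affine_majorant (k c : R) :=
  forall a b, rho a b <= k * d (set_val a) (set_val b) + c.

(** The candidate [N] caps the infimum at the norm; the restriction [1 <= k] keeps it above
    [Num.min N (d x y)], hence positive off the diagonal when [0 < N]. *)
Let bounds (x y : X) : set R := [set s | s = N \/ exists k c,
  [/\ 1 <= k, 0 <= c, affine_majorant k c & s = k * d x y + c]].

Let bounds_ge0 x y : lbound (bounds x y) 0.
Proof.
have [d0 _ _ _] := cpm_is_pseudometric d.
move=> _ [->//|[k [c [k1 c0 _ ->]]]].
by rewrite addr_ge0// mulr_ge0// (le_trans ler01).
Qed.

(** On the compact square of [A], [d] vanishes only on the diagonal, where [rho] vanishes too, so a
    multiple of [d] dominates [rho] up to [e]. *)
Let small_majorant (e : R) : 0 < e ->
  exists2 k, 1 <= k & affine_majorant k e.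
Proof.
move=> e0.
have [d0 _ _ _] := cpm_is_pseudometric d.
have cAA : compact [set: set_type A * set_type A].
  by rewrite -setXTT; apply: compact_setX; exact: compact_set_type.
have cval : continuous (set_val : set_type A -> X) by exact: initial_continuous.
have [|||n nP] := @compact_dominated R (set_type A * set_type A)%type
  (fun p => rho p.1 p.2) (fun p => d (set_val p.1) (set_val p.2)) e cAA
  (@cpm_continuous _ _ rho) _ _ _ e0.
- apply: cpm_continuous_comp => p.
    by apply: (cvg_comp fst set_val); [exact: cvg_fst|exact: cval].
  by apply: (cvg_comp snd set_val); [exact: cvg_snd|exact: cval].
- by move=> p; exact: d0.
- move=> [a b] /= /d_metric.2 /val_inj ->.
  by have [_ -> _ _] := cpm_is_pseudometric rho.
(* Adding 1 brings the slope into the range allowed in [bounds]. *)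
- exists (n%:R + 1); first by rewrite lerDr.
  move=> a b; apply: le_trans (nP (a, b)) _ => /=.
  by rewrite lerD2r ler_wpM2r// lerDl.
Qed.

Lemma cpm_majorant : exists delta : cont_pseudometric R X,
  [/\ forall a b, rho a b <= delta (set_val a) (set_val b),
      forall x y, delta x y <= N & 0 < N -> is_metric delta].
Proof.
have [d0 dxx dC dT] := cpm_is_pseudometric d.
have boundsn0 x y : bounds x y !=set0 by exists N; left.
have blb x y : has_lbound (bounds x y) by exists 0.
have pm : is_pseudometric (fun x y => inf (bounds x y)).
  apply: is_pseudometric_inf => //.
  - move=> x e /[dup] e0 /small_majorant[k k1 ke]; exists (k * d x x + e).
      by right; exists k, e; split => //; exact: ltW.
    by rewrite dxx mulr0 add0r.
  - by move=> x y s; rewrite /bounds /= dC.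
  - move=> x y z s t [->|[k [c [k1 c0 kc ->]]]] Bt.
      by exists N; [left|rewrite lerDl; exact: bounds_ge0 Bt].
    case: Bt => [->|[l [b [l1 b0 lb ->]]]].
      by exists N; [left|rewrite lerDr addr_ge0// mulr_ge0// (le_trans ler01)].
    (* subadditivity: use the smaller of the two slopes throughout *)
    have [kl|/ltW lk] := leP k l.
      exists (k * d x z + c); first by right; exists k, c.
      have : k * d x z <= k * (d x y + d y z) by rewrite ler_wpM2l ?(le_trans ler01).
      have : k * d y z <= l * d y z by rewrite ler_wpM2r.
      by lra.
    exists (l * d x z + b); first by right; exists l, b.
    have : l * d x z <= l * (d x y + d y z) by rewrite ler_wpM2l ?(le_trans ler01).
    have : l * d x y <= k * d x y by rewrite ler_wpM2r.
    by lra.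
have cont : continuous (fun p : X * X => inf (bounds p.1 p.2)).
  (* A single affine candidate with constant [e / 2] suffices: its linear term is below [e / 2] on
     the [d]-ball of radius [e / 2 / k]. *)
  apply: (pseudometric_continuous _ pm) => x e e0.
  have e20 : 0 < e / 2 by rewrite divr_gt0.
  have [k k1 ke] := small_majorant _ e20.
  have k0 : 0 < k by exact: lt_le_trans k1.
  near=> y.
  have dxy : d x y < e / 2 / k by near: y; apply: cpm_near; rewrite divr_gt0.
  have : inf (bounds x y) <= k * d x y + e / 2.
    by apply: ge_inf => //; right; exists k, (e / 2); split => //; exact: ltW.
  by move: dxy; rewrite ltr_pdivlMr// mulrC; lra.
exists (ContPseudometric pm cont); split => /= [a b|x y|N0].
- by apply: lb_le_inf => // _ [->|[k [c [_ _ kc ->]]]].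
- by apply: ge_inf => //; left.
- split=> // x y /= infxy0; apply: d_metric.2; apply/eqP; rewrite eq_le d0 andbT.
  rewrite leNgt; apply/negP => dxy.
  suff : Num.min N (d x y) <= inf (bounds x y).
    by rewrite infxy0 leNgt lt_min N0 dxy.
  apply: lb_le_inf => // _ [->|[k [c [k1 c0 _ ->]]]]; first by rewrite ge_min lexx.
  have : d x y <= k * d x y by rewrite ler_peMl.
  by rewrite ge_min => ?; apply/orP; right; lra.
Unshelve. all: end_near. Qed.

End majorant.

(** * Gluing [rho] into a dominating pseudometric *)

Section gluing.
Context {R : realType} {X : topologicalType} {A : set X}.
Variables (delta : cont_pseudometric R X).
Variables (rho : cont_pseudometric R (set_type A)).
Hypothesis rho_le : forall a b, rho a b <= delta (set_val a) (set_val b).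

(** Lengths of paths that use [rho] at most once. Longer chains bring nothing shorter, because [rho]
    is dominated by [delta] on [A]. *)
Let lengths (x y : X) : set R := [set s | s = delta x y \/
  exists a b, s = delta x (set_val a) + rho a b + delta (set_val b) y].

Let lengths_ge0 x y : lbound (lengths x y) 0.
Proof.
have [delta0 _ _ _] := cpm_is_pseudometric delta.
have [rho0 _ _ _] := cpm_is_pseudometric rho.
by move=> _ [->|[a [b ->]]]//; rewrite !addr_ge0.
Qed.

Lemma cpm_glue : exists tau : cont_pseudometric R X,
  [/\ forall a b, tau (set_val a) (set_val b) = rho a b,
      forall x y, tau x y <= delta x y
    & A !=set0 -> compact A -> is_metric delta -> is_metric rho -> is_metric tau].
Proof.
have [delta0 deltaxx deltaC deltaT] := cpm_is_pseudometric delta.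
have [rho0 rhoxx rhoC rhoT] := cpm_is_pseudometric rho.
have lengths_delta x y : lengths x y (delta x y) by left.
have lengthsn0 x y : lengths x y !=set0 by exists (delta x y).
have lengthslb x y : has_lbound (lengths x y) by exists 0.
have pm : is_pseudometric (fun x y => inf (lengths x y)).
  apply: is_pseudometric_inf => //.
  - by move=> x e e0; exists (delta x x) => //; rewrite deltaxx ltW.
  - move=> x y _ [->|[a [b ->]]]; first by left; rewrite deltaC.
    right; exists b, a; rewrite (deltaC x) (deltaC _ y) (rhoC a); ring.
  - move=> x y z _ _ [->|[a [b ->]]] [->|[a' [b' ->]]].
    + by exists (delta x z).
    + exists (delta x (set_val a') + rho a' b' + delta (set_val b') z).
        by right; exists a', b'.
      by have := deltaT x y (set_val a'); lra.
    + exists (delta x (set_val a) + rho a b + delta (set_val b) z).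
        by right; exists a, b.
      by have := deltaT (set_val b) y z; lra.
    (* The [delta]-legs from [b] to [y] to [a'] cost at least [rho b a'], so the two passages
       through [A] merge into one from [a] to [b']. *)
    + exists (delta x (set_val a) + rho a b' + delta (set_val b') z).
        by right; exists a, b'.
      have := deltaT (set_val b) y (set_val a'); have := rho_le b a'.
      by have := rhoT a b b'; have := rhoT b a' b'; lra.
have cont : continuous (fun p : X * X => inf (lengths p.1 p.2)).
  apply: (pseudometric_continuous _ pm) => x e e0; near=> y.
  apply: (@le_lt_trans _ _ (delta x y)); first exact: ge_inf.
  by near: y; exact: cpm_near.
(* Upper bound: the path with both [delta]-legs trivial. Lower bound: between points of [A] each
   [delta]-leg costs at least the corresponding [rho]-distance. *)
have ext a b : inf (lengths (set_val a) (set_val b)) = rho a b.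
  apply/eqP; rewrite eq_le; apply/andP; split.
    by apply: ge_inf => //; right; exists a, b; rewrite !deltaxx addr0 add0r.
  apply: lb_le_inf => // _ [->//|[a' [b' ->]]].
  have := rho_le a a'; have := rho_le b' b.
  by have := rhoT a a' b; have := rhoT a' b' b; lra.
exists (ContPseudometric pm cont).
split => //= [x y|A0 cA [_ delta_eq0] [_ rho_eq0]].
  exact: ge_inf.
have [a0 _] : [set: set_type A] !=set0.
  by have [p Ap] := A0; exists (exist _ p (mem_set Ap)).
(* The [delta]-distance from [x] to the compact set [A] is attained at some [c], hence positive. A
   path through [A] is at least that long, and the direct one has length [delta x y]. *)
have outside x y : ~ A x -> inf (lengths x y) = 0 -> x = y.
  move=> nAx infxy0.
  have [|c _ cmin] := @compact_EVT_min _ _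
    (fun a : set_type A => delta x (set_val a)) [set: set_type A]
    (ex_intro _ a0 I) (compact_set_type cA).
    apply: continuous_subspaceT.
    apply: (cpm_continuous_comp delta (fun=> x) set_val) => p.
      exact: cst_continuous.
    exact: initial_continuous.
  have c_gt0 : 0 < delta x (set_val c).
    rewrite lt_neqAle delta0 andbT; apply/eqP => /esym /delta_eq0 xc.
    by apply: nAx; rewrite xc; exact: set_valP.
  apply: delta_eq0; apply/eqP; rewrite eq_le delta0 andbT leNgt; apply/negP => xy.
  suff : Num.min (delta x y) (delta x (set_val c)) <= inf (lengths x y).
    by rewrite infxy0 leNgt lt_min xy c_gt0.
  apply: lb_le_inf => // _ [->|[a [b ->]]]; first by rewrite ge_min lexx.
  rewrite ge_min; apply/orP; right; have := cmin a (mem_set I).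
  by have := rho0 a b; have := delta0 (set_val b) y; lra.
split=> // x y /= infxy0.
(* If either point lies outside [A], the previous step applies, up to symmetry; if both lie in [A],
   the infimum is [rho], which separates them. *)
have [Ax|/outside] := pselect (A x); last exact.
have [Ay|nAy] := pselect (A y); last first.
  by apply/esym/outside => //; have [_ _ -> _] := pm.
have := ext (exist _ x (mem_set Ax)) (exist _ y (mem_set Ay)).
by rewrite /set_val /= infxy0 => /esym /rho_eq0 [].
Unshelve. all: end_near. Qed.

End gluing.

Theorem theorem5p1 (R : realType) (X : topologicalType)
    (X_compact : compact [set: X])
    (X_metrizable : metrizable R X)
    (X_two_points : exists x y : X, x <> y) :
  exists u : partial_pseudometric R X -> cont_pseudometric R X,
    [/\ regular u,
        extension_operator u
      & forall rho, Mtilde rho -> is_metric (u rho)].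
Proof.
have [d0 [d0_pm d0_eq0] d0_nbhs] := X_metrizable.
have d0_cont : continuous (fun p : X * X => d0 p.1 p.2).
  by apply: (pseudometric_continuous _ d0_pm) => x e e0; apply/d0_nbhs; exists e.
pose d := ContPseudometric d0_pm d0_cont.
suff /choice[u uP] : forall rho : partial_pseudometric R X,
    exists tau : cont_pseudometric R X,
    [/\ cpm_norm tau = cpm_norm (pm_dist rho),
        forall a b : set_type (pm_dom rho),
          tau (set_val a) (set_val b) = pm_dist rho a b
      & Mtilde rho -> is_metric tau].
  by exists u; split=> [rho|rho|rho]; have [] := uP rho.
move=> [A cA A0 rho] /=.
have rho_le a b : rho a b <= cpm_norm rho.
  exact: cpm_le_norm (compact_set_type cA).
have [rho0 rhoxx _ _] := cpm_is_pseudometric rho.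
have [p Ap] := A0; pose a0 : set_type A := exist _ p (mem_set Ap).
have N0 : 0 <= cpm_norm rho by rewrite -(rhoxx a0) rho_le.
have [delta [rho_delta delta_le delta_metric]] :=
  cpm_majorant d rho _ (conj d0_pm d0_eq0) cA N0 rho_le.
have [tau [tau_ext tau_le tau_metric]] := cpm_glue delta rho rho_delta.
exists tau; split=> //.
(* The chain [tau <= delta <= N] gives one inequality; the other holds because [tau] takes all the
   values of [rho]. *)
- apply/eqP; rewrite eq_le; apply/andP; split.
    apply: ge_sup; first by exists (tau p p), (p, p).
    by move=> _ [q _ <-]; exact: le_trans (tau_le _ _) (delta_le _ _).
  apply: ge_sup; first by exists (rho a0 a0), (a0, a0).
  by move=> _ [q _ <-]; rewrite -tau_ext; exact: cpm_le_norm.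
- move=> [/= rho_metric [x [y [Ax Ay xy]]]].
  apply: tau_metric => //; apply: delta_metric.
  pose a : set_type A := exist _ x (mem_set Ax).
  pose b : set_type A := exist _ y (mem_set Ay).
  (* Two distinct points of the domain make the norm positive, which is what [delta] needs to be a
     metric. *)
  apply: lt_le_trans (rho_le a b); rewrite lt_neqAle rho0 andbT.
  by apply/eqP => /esym /rho_metric.2 [].
Qed.
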